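(* Let $K$ be a finite extension of $\mathbb{F}_q$ of degree $d$, let $\gamma:\mathbb{F}_q[T]\to K$ be a morphism of $\mathbb{F}_q$-algebras, and let $p\in\mathbb{F}_q[T]$ be the monic generator of $\ker(\gamma)$. Let $\phi$ be a Drinfeld $\mathbb{F}_q[T]$-module over $(K,\gamma)$, and let $g_\phi\in\mathbb{F}_q[T]$ be the gcd of the $\mathbb{F}_q[T]$-coordinates of the element $\tau^d-1$ of the Anderson motive $\mathbb{M}(\phi)$. If $a\in\mathbb{F}_q[T]$ is coprime to $p$, then the $a$-torsion of $\phi$ is rational if and only if $a$ divides $g_\phi$.
   Context: $\tau$ is the Frobenius $x\mapsto x^q$ on an algebraic closure $\overline K$ of $K$; $K\{\tau\}$ is the $\mathbb{F}_q$-algebra of Ore polynomials $\sum_{i=0}^n x_i\tau^i$ ($x_i\in K$), with addition and composition of endomorphisms of $\overline K$. A Drinfeld $\mathbb{F}_q[T]$-module over $(K,\gamma)$ is a morphism of $\mathbb{F}_q$-algebras $\phi:\mathbb{F}_q[T]\to K\{\tau\}$, $a\mapsto\phi_a$, with image not contained in $K$ and such that the constant coefficient of $\phi_a$ is $\gamma(a)$ for all $a$. Its rank is $r=\deg_\tau(\phi_T)$. The $a$-torsion of $\phi$ is $\phi[a]=\ker(\phi_a)\subset\overline K$; it is rational (i.e. $K$-rational) if $\phi[a]\subset K$. The Anderson motive $\mathbb{M}(\phi)$ is $K\{\tau\}$ endowed with the $K[T]$-module structure $\left(\sum_i\lambda_iT^i\right)\cdot f=\sum_i\lambda_i f\phi_{T^i}$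 ($\lambda_i\in K$, $f\in K\{\tau\}$). It is a free $K[T]$-module with canonical basis $1,\tau,\dots,\tau^{r-1}$; consequently, given an $\mathbb{F}_q$-basis $(\varepsilon_1,\dots,\varepsilon_d)$ of $K$, it is a free $\mathbb{F}_q[T]$-module with basis $(\varepsilon_i\tau^j)_{1\leqslant i\leqslant d,\,0\leqslant j\leqslant r-1}$. The $\mathbb{F}_q[T]$-coordinates of an element are its coordinates in this basis (their gcd does not depend on the choice of $\mathbb{F}_q[T]$-basis). *)

(* Defs.v *)
From HB Require Import structures.
From mathcomp Require Import all_boot all_order all_algebra all_field.

Set Implicit Arguments.
Unset Strict Implicit.
Unset Printing Implicit Defensive.

Import GRing.Theory.
Local Open Scope ring_scope.

Section Ore.

Variables (F : finFieldType) (K : fieldExtType F).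

Local Notation q := #|F|.

Lemma card_pchar_nat (E : fieldExtType F) i : [pchar E].-nat (q ^ i)%N.
Proof.
have [p p_pr pF] := finPcharP F.
have pE : p \in [pchar E] by rewrite pchar_lalg.
have := abelian.fin_ring_pchar_abelem pF => /abelian.abelem_pgroup.
by rewrite /pgroup.pgroup cardsT => qp; rewrite pnatX (eq_pnat _ (pcharf_eq pE)) qp.
Qed.

Definition frob (i : nat) (x : K) : K := x ^+ (q ^ i).

Fact frob_is_zmod_morphism i : zmod_morphism (frob i).
Proof. by move=> x y; rewrite /frob exprDn_pchar ?exprNn_pchar ?card_pchar_nat. Qed.

Fact frob_is_monoid_morphism i : monoid_morphism (frob i).
Proof. by split=> [|x y]; rewrite /frob ?expr1n ?exprMn. Qed.

HB.instance Definition _ i :=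
  GRing.isZmodMorphism.Build K K (frob i) (frob_is_zmod_morphism i).
HB.instance Definition _ i :=
  GRing.isMonoidMorphism.Build K K (frob i) (frob_is_monoid_morphism i).

Lemma frob0 x : frob 0 x = x. Proof. by []. Qed.

Lemma frobD i j x : frob (i + j) x = frob i (frob j x).
Proof. by rewrite /frob -exprM -expnD addnC. Qed.

Lemma frob_in_alg i (k : F) : frob i k%:A = k%:A.
Proof.
rewrite /frob; elim: i => [|i IHi]; first by rewrite expr1.
by rewrite expnSr exprM IHi -in_algE -rmorphXn /= expf_card.
Qed.

(* The Ore polynomial \sum_i x_i tau^i is encoded by its coefficients, as the
   polynomial \sum_i x_i 'X^i; the product is the one forced by
   tau * x = x ^ q * tau, i.e., composition of endomorphisms of an algebraic
   closure of K: see ore_evalM and ore_eval_inj. *)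
Definition ore : Type := {poly K}.

HB.instance Definition _ := GRing.Zmodule.copy ore {poly K}.

Implicit Types f g h : ore.

Definition ore_mul f g : ore :=
  \poly_(k < size f + size g) \sum_(i < k.+1) f`_i * g`_(k - i) ^+ (q ^ i).

Lemma coef_ore_mul f g k :
  (ore_mul f g)`_k = \sum_(i < k.+1) f`_i * frob i g`_(k - i).
Proof.
rewrite coef_poly; case: ltnP => // le_fg_k.
rewrite big1 // => i _; have [le_f_i|lt_i_f] := leqP (size f) i.
  by rewrite nth_default ?mul0r.
rewrite [g`__]nth_default ?rmorph0 ?mulr0 // leq_subRL; last by rewrite -ltnS.
by rewrite (leq_trans _ le_fg_k) // leq_add2r ltnW.
Qed.

Lemma coef_ore_mul_rev f g k :
  (ore_mul f g)`_k = \sum_(i < k.+1) f`_(k - i) * frob (k - i) g`_i.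
Proof.
rewrite coef_ore_mul (reindex_inj rev_ord_inj) /=.
by apply: eq_bigr => i _; rewrite subSS (sub_ordK i).
Qed.

Fact ore_mulA : associative ore_mul.
Proof.
move=> f g h; apply/polyP=> i; rewrite coef_ore_mul coef_ore_mul_rev.
pose c j k := f`_j * frob j (g`_(i - j - k) * frob (i - j - k) h`_k).
transitivity (\sum_(j < i.+1) \sum_(k < i.+1 | (k <= i - j)%N) c j k).
  apply: eq_bigr => /= j _; rewrite coef_ore_mul_rev rmorph_sum big_distrr /=.
  by rewrite (big_ord_narrow_leq (leq_subr _ _)).
rewrite (exchange_big_dep predT) //=; apply: eq_bigr => k _.
transitivity (\sum_(j < i.+1 | (j <= i - k)%N) c j k).
  apply: eq_bigl => j; rewrite -ltnS -(ltnS j) -!subSn ?leq_ord //.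
  by rewrite -subn_gt0 -(subn_gt0 j) -!subnDA addnC.
rewrite (big_ord_narrow_leq (leq_subr _ _)) coef_ore_mul big_distrl /=.
apply: eq_bigr => j _; rewrite /c [X in _ * X]rmorphM -[X in _ * (_ * X)]frobD.
have le_jik : (j <= i - k)%N by rewrite -ltnS.
have -> : (i - j - k = i - k - j)%N by rewrite -!subnDA addnC.
by rewrite subnKC // mulrA.
Qed.

Fact ore_mul1r : left_id (1%:P : ore) ore_mul.
Proof.
move=> f; apply/polyP => i; rewrite coef_ore_mul big_ord_recl subn0 coefC /=.
rewrite mul1r frob0 big1 ?addr0 // => j _.
by rewrite coefC /= mul0r.
Qed.

Fact ore_mulr1 : right_id (1%:P : ore) ore_mul.
Proof.
move=> f; apply/polyP => i; rewrite coef_ore_mul_rev big_ord_recl subn0 coefC.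
rewrite rmorph1 mulr1 big1 ?addr0 // => j _.
by rewrite coefC /= rmorph0 mulr0.
Qed.

Fact ore_mulDl : left_distributive ore_mul +%R.
Proof.
move=> f g h; apply/polyP=> i; rewrite coefD !coef_ore_mul -big_split.
by apply: eq_bigr => j _; rewrite coefD mulrDl.
Qed.

Fact ore_mulDr : right_distributive ore_mul +%R.
Proof.
move=> f g h; apply/polyP=> i; rewrite coefD !coef_ore_mul -big_split.
by apply: eq_bigr => j _; rewrite coefD rmorphD mulrDr.
Qed.

Fact ore_1neq0 : (1%:P : ore) != 0.
Proof. exact: (oner_neq0 {poly K}). Qed.

HB.instance Definition _ := GRing.Zmodule_isNzRing.Build ore
  ore_mulA ore_mul1r ore_mulr1 ore_mulDl ore_mulDr ore_1neq0.

Lemma coef_oreM f g k :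
  (f * g : ore)`_k = \sum_(i < k.+1) f`_i * frob i g`_(k - i).
Proof. exact: coef_ore_mul. Qed.

Definition oreC (x : K) : ore := x%:P.

Definition tau : ore := 'X.

Fact oreC_is_zmod_morphism : zmod_morphism oreC.
Proof. exact: (raddfB (@polyC K)). Qed.

Fact oreC_is_monoid_morphism : monoid_morphism oreC.
Proof.
split=> // x y; apply/polyP=> i; rewrite coef_oreM big_ord_recl subn0 !coefC /=.
by rewrite big1 ?addr0; [case: (i == 0)%N; rewrite ?frob0 ?mulr0|
  move=> j _; rewrite !coefC /= mul0r].
Qed.

HB.instance Definition _ :=
  GRing.isZmodMorphism.Build K ore oreC oreC_is_zmod_morphism.
HB.instance Definition _ :=
  GRing.isMonoidMorphism.Build K ore oreC oreC_is_monoid_morphism.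

Lemma coef_oreCM x f k : (oreC x * f : ore)`_k = x * f`_k.
Proof.
rewrite coef_oreM big_ord_recl subn0 coefC frob0 big1 ?addr0 // => j _.
by rewrite coefC /= mul0r.
Qed.

Lemma coef_oreMtau f k : (f * tau : ore)`_k = if k is k'.+1 then f`_k' else 0.
Proof.
rewrite coef_oreM; case: k => [|k].
  by rewrite big_ord1 coefX rmorph0 mulr0.
rewrite big_ord_recr big_ord_recr /= subnn subSnn !coefX rmorph0 rmorph1.
rewrite mulr0 mulr1 addr0 big1 ?add0r // => i _.
by rewrite coefX subSn 1?ltnW // eqSS subn_eq0 leqNgt ltn_ord rmorph0 mulr0.
Qed.

Lemma tauX n : tau ^+ n = 'X^n :> {poly K}.
Proof.
elim: n => [|n IHn] //; apply/polyP=> -[|i]; rewrite exprSr coef_oreMtau.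
  by rewrite coefXn.
by rewrite IHn !coefXn.
Qed.

Lemma tau_oreC n x : tau ^+ n * oreC x = oreC (x ^+ (q ^ n)) * tau ^+ n.
Proof.
apply/polyP=> k; rewrite coef_oreCM tauX coef_oreM coefXn.
have [->|ne_kn] := eqVneq k n; last first.
  rewrite big1 ?mulr0 // => i _; rewrite coefC coefXn subn_eq0 leqNgt.
  have [Ein|] := eqVneq (i : nat) n; last by rewrite mul0r.
  by rewrite Ein ltn_neqAle eq_sym ne_kn -ltnS -Ein ltn_ord rmorph0 mulr0.
rewrite big_ord_recr /= subnn coefC coefXn eqxx mul1r mulr1 big1 ?add0r //.
by move=> i _; rewrite coefXn ltn_eqF ?mul0r // ltn_ord.
Qed.

Definition ore_scale (k : F) f : ore := oreC k%:A * f.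

Fact ore_scaleA a b f : ore_scale a (ore_scale b f) = ore_scale (a * b) f.
Proof. by rewrite /ore_scale mulrA -rmorphM /= -!in_algE -rmorphM. Qed.

Fact ore_scale1r : left_id 1 ore_scale.
Proof. by move=> f; rewrite /ore_scale scale1r rmorph1 mul1r. Qed.

Fact ore_scaleDr : right_distributive ore_scale +%R.
Proof. by move=> a f g; rewrite /ore_scale mulrDr. Qed.

Fact ore_scaleDl f : {morph ore_scale^~ f : a b / a + b}.
Proof. by move=> a b; rewrite /ore_scale scalerDl rmorphD mulrDl. Qed.

HB.instance Definition _ := GRing.Zmodule_isLmodule.Build F ore
  ore_scaleA ore_scale1r ore_scaleDr ore_scaleDl.

Fact ore_scaleAl (a : F) f g : a *: (f * g) = (a *: f) * g.
Proof. exact: mulrA. Qed.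

HB.instance Definition _ := GRing.Lmodule_isLalgebra.Build F ore ore_scaleAl.

Fact ore_scaleAr (a : F) f g : a *: (f * g) = f * (a *: g).
Proof.
apply/polyP=> k; rewrite coef_oreCM !coef_oreM mulr_sumr.
apply: eq_bigr => i _; rewrite coef_oreCM rmorphM mulrCA.
by congr (_ * (_ * _)); rewrite [RHS]frob_in_alg.
Qed.

HB.instance Definition _ := GRing.Lalgebra_isAlgebra.Build F ore ore_scaleAr.

End Ore.

Arguments tau {F K}.
Arguments oreC {F K} x.

Section Eval.

Variables (F : finFieldType) (K : fieldExtType F).
Variables (E : fieldType) (iota : {rmorphism K -> E}).

Local Notation q := #|F|.

Definition ore_eval (f : ore K) (z : E) : E :=
  \sum_(i < size f) iota f`_i * z ^+ (q ^ i).

Lemma ore_eval_wide n (f : ore K) z : (size f <= n)%N ->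
  ore_eval f z = \sum_(i < n) iota f`_i * z ^+ (q ^ i).
Proof.
move=> le_fn; pose G i := iota f`_i * z ^+ (q ^ i).
rewrite /ore_eval (big_ord_widen n G le_fn) big_mkcond.
apply: eq_bigr => i _; case: ltnP => // le_fi.
by rewrite nth_default ?rmorph0 ?mul0r.
Qed.

Lemma ore_evalD (f g : ore K) z :
  ore_eval (f + g) z = ore_eval f z + ore_eval g z.
Proof.
pose n := maxn (size f) (size g).
rewrite !(@ore_eval_wide n) ?leq_maxl ?leq_maxr ?size_polyD // -big_split.
by apply: eq_bigr => i _; rewrite coefD rmorphD mulrDl.
Qed.

Lemma ore_evalCM x (f : ore K) z :
  ore_eval (oreC x * f) z = iota x * ore_eval f z.
Proof.
rewrite (@ore_eval_wide (size f)).
  rewrite mulr_sumr; apply: eq_bigr => i _.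
  by rewrite coef_oreCM rmorphM mulrA.
by apply/leq_sizeP => i le_fi; rewrite coef_oreCM nth_default ?mulr0.
Qed.

Lemma ore_evalMtau (f : ore K) z : ore_eval (f * tau) z = ore_eval f (z ^+ q).
Proof.
rewrite (@ore_eval_wide (size f).+1) /ore_eval.
  rewrite big_ord_recl coef_oreMtau rmorph0 mul0r add0r.
  by apply: eq_bigr => i _; rewrite coef_oreMtau -exprM -expnS.
by apply/leq_sizeP => -[|i] // le_fi; rewrite coef_oreMtau nth_default.
Qed.

Lemma ore_eval_tauM (f : ore K) z : ore_eval (tau * f) z = ore_eval f z ^+ q.
Proof.
have coef_tauM k : (tau * f : ore K)`_k = if k is k'.+1 then f`_k' ^+ q else 0.
  rewrite coef_oreM; case: k => [|k]; first by rewrite big_ord1 coefX mul0r.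
  rewrite 2!big_ord_recl !coefX mul0r add0r mul1r big1 ?addr0 => [|i _].
    by rewrite subSS subn0 /frob expn1.
  by rewrite coefX mul0r.
have qE : [pchar E].-nat q.
  by rewrite (eq_pnat _ (fmorph_pchar iota)) -[q]expn1 card_pchar_nat.
have exp_sum n (G : 'I_n -> E) : (\sum_i G i) ^+ q = \sum_i G i ^+ q.
  elim/big_rec2: _ => [|i y1 y2 _ <-]; last by rewrite exprDn_pchar.
  by rewrite expr0n gtn_eqF // (ltnW (finNzRing_gt1 F)).
rewrite (@ore_eval_wide (size f).+1) /ore_eval; last first.
  apply/leq_sizeP => -[|i] // le_fi; rewrite coef_tauM nth_default //.
  by rewrite expr0n gtn_eqF // (ltnW (finNzRing_gt1 F)).
rewrite big_ord_recl coef_tauM rmorph0 mul0r add0r exp_sum.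
by apply: eq_bigr => i _; rewrite coef_tauM exprMn rmorphXn expnSr exprM.
Qed.

Lemma ore_evalM (f g : ore K) z :
  ore_eval (f * g) z = ore_eval f (ore_eval g z).
Proof.
elim/poly_ind: f g => [|f c IHf] g.
  by rewrite mul0r /ore_eval size_poly0 !big_ord0.
have -> : f * 'X + c%:P = (f : ore K) * tau + oreC c :> ore K.
  apply/polyP => k; rewrite !coefD coefMX coef_oreMtau.
  by case: k.
rewrite mulrDl !ore_evalD -mulrA IHf ore_eval_tauM ore_evalMtau ore_evalCM.
by congr (_ + _); rewrite -[oreC c]mulr1 ore_evalCM /ore_eval size_polyC oner_eq0
  big_ord1 coefC rmorph1 mul1r expr1.
Qed.

End Eval.

Lemma ore_eval_inj (F : finFieldType) (K : fieldExtType F)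
    (E : closedFieldType) (iota : {rmorphism K -> E}) (f g : ore K) :
  ore_eval iota f =1 ore_eval iota g -> f = g.
Proof.
move=> Efg; pose h := f - g.
have h0 z : ore_eval iota h z = 0.
  by apply: (addIr (ore_eval iota g z)); rewrite -ore_evalD subrK Efg add0r.
pose P := \sum_(i < size h) iota h`_i *: 'X^(#|F| ^ i).
have hornerP z : P.[z] = 0.
  rewrite -[RHS](h0 z) horner_sum; apply: eq_bigr => i _.
  by rewrite hornerZ hornerXn.
have P0 : P = 0.
  have [/size1_polyC EP | P_gt1] := leqP (size P) 1.
    by have := hornerP 0; rewrite EP hornerC => ->; rewrite polyC0.
  have /closed_rootP[w] : size (P + 1) != 1%N.
    by rewrite size_polyDl ?size_poly1 // gtn_eqF.
  by rewrite rootE hornerD hornerP hornerC add0r oner_eq0.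
apply/eqP; rewrite -subr_eq0 -/h; apply/eqP/polyP => k; rewrite coef0.
have [lt_kh | le_hk] := ltnP k (size h); last by rewrite nth_default.
apply: (fmorph_inj iota); rewrite rmorph0 -[RHS](coef0 E (#|F| ^ k)) -P0 coef_sum.
rewrite (bigD1 (Ordinal lt_kh)) //= coefZ coefXn eqxx mulr1 big1 ?addr0 // => i.
rewrite -val_eqE /= eq_sym coefZ coefXn eqn_exp2l ?finNzRing_gt1 // => /negPf->.
by rewrite mulr0.
Qed.

(* A Drinfeld F[T]-module over (K, gamma), with T the variable 'X. *)
Record drinfeld (F : finFieldType) (K : fieldExtType F)
    (gamma : {lrmorphism {poly F} -> K}) := Drinfeld {
  drinfeld_mor :> {lrmorphism {poly F} -> ore K};
  drinfeld_nonconst : exists a, forall x, drinfeld_mor a <> oreC x;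
  drinfeld_coef0 : forall a, (drinfeld_mor a : ore K)`_0 = gamma a
}.

(* The parameter phi selects the K[T]-module structure. *)
Definition motive (F : finFieldType) (K : fieldExtType F)
  (gamma : {lrmorphism {poly F} -> K}) (phi : drinfeld gamma) : Type := ore K.

Section Drinfeld.

Variables (F : finFieldType) (K : fieldExtType F).
Variables (gamma : {lrmorphism {poly F} -> K}) (phi : drinfeld gamma).

Definition rank : nat := (size (phi 'X : ore K)).-1.

Definition torsion (E : fieldType) (iota : {rmorphism K -> E}) (a : {poly F})
  : {pred E} := [pred z | ore_eval iota (phi a) z == 0].

Definition rational_torsion (E : fieldType) (iota : {rmorphism K -> E})
    (a : {poly F}) : Prop :=
  forall z, z \in torsion iota a -> exists x : K, z = iota x.

Local Notation motive := (motive phi).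

HB.instance Definition _ := GRing.Zmodule.copy motive (ore K).

Definition motive_scale (P : {poly K}) (m : motive) : motive :=
  \sum_(i < size P) oreC P`_i * (m : ore K) * phi 'X^i.

Lemma motive_scale_wide n (P : {poly K}) (m : motive) : (size P <= n)%N ->
  motive_scale P m = \sum_(i < n) oreC P`_i * (m : ore K) * phi 'X^i.
Proof.
move=> le_Pn; pose G i := oreC P`_i * (m : ore K) * phi 'X^i.
rewrite /motive_scale (big_ord_widen n G le_Pn) big_mkcond.
apply: eq_bigr => i _; case: ltnP => // le_Pi.
by rewrite nth_default ?rmorph0 ?mul0r.
Qed.

Fact motive_scaleDl m : {morph motive_scale^~ m : P Q / P + Q}.
Proof.
move=> P Q; pose n := maxn (size P) (size Q).
rewrite !(@motive_scale_wide n) ?leq_maxl ?leq_maxr ?size_polyD // -big_split.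
by apply: eq_bigr => i _; rewrite coefD rmorphD !mulrDl.
Qed.

Fact motive_scaleDr : right_distributive motive_scale +%R.
Proof.
move=> P m m'; rewrite /motive_scale -big_split.
by apply: eq_bigr => i _; rewrite mulrDr mulrDl.
Qed.

Lemma motive_scaleZXn x n (m : motive) :
  motive_scale (x *: 'X^n) m = oreC x * (m : ore K) * phi 'X^n.
Proof.
rewrite (@motive_scale_wide n.+1); last first.
  by rewrite (leq_trans (size_scale_leq _ _)) ?size_polyXn.
rewrite big_ord_recr /= coefZ coefXn eqxx mulr1 big1 ?add0r // => i _.
by rewrite coefZ coefXn ltn_eqF // mulr0 rmorph0 !mul0r.
Qed.

Lemma motive_scale_suml m I (s : seq I) (G : I -> {poly K}) :
  motive_scale (\sum_(i <- s) G i) m = \sum_(i <- s) motive_scale (G i) m.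
Proof.
apply: (big_morph (motive_scale^~ m) (motive_scaleDl m)).
by rewrite /motive_scale size_poly0 big_ord0.
Qed.

Fact motive_scaleA P Q m :
  motive_scale P (motive_scale Q m) = motive_scale (P * Q) m.
Proof.
rewrite -[P in RHS]coefK -[Q in RHS]coefK !poly_def mulr_suml motive_scale_suml.
apply: eq_bigr => i _; rewrite mulr_sumr mulr_suml mulr_sumr motive_scale_suml.
apply: eq_bigr => j _; rewrite -scalerAl -scalerAr scalerA -exprD.
rewrite motive_scaleZXn [oreC (_ * _)]rmorphM addnC exprD.
by rewrite [phi (_ * _)]rmorphM !mulrA.
Qed.

Fact motive_scale1r : left_id 1 motive_scale.
Proof.
move=> m; have := motive_scaleZXn 1 0 m.
by rewrite scale1r expr0 !rmorph1 mul1r mulr1.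
Qed.

HB.instance Definition _ := GRing.Zmodule_isLmodule.Build {poly K} motive
  motive_scaleA motive_scale1r motive_scaleDr motive_scaleDl.

(* The underlying F[T]-module structure, by restriction from K[T]. *)
Definition motive_scale_Fq (a : {poly F}) (m : motive) : motive :=
  map_poly (in_alg K) a *: m.

Lemma motive_scale_FqE a (m : motive) :
  motive_scale_Fq a m = (m : ore K) * phi a.
Proof.
rewrite -{2}[a]coefK poly_def linear_sum mulr_sumr.
transitivity (motive_scale (map_poly (in_alg K) a) m) => //.
rewrite (@motive_scale_wide (size a)) ?size_poly //; apply: eq_bigr => i _.
by rewrite coef_map linearZ -[RHS]scalerAr [RHS]scalerAl.
Qed.

Variables (d : nat) (eps : d.-tuple K).

(* The family eps_i tau^j; see coords_exist and coords_unique for the proof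
   that it is an F[T]-basis when eps is an F-basis of K. *)
Definition motive_basis (i : 'I_d) (j : 'I_rank) : motive :=
  oreC (tnth eps i) * tau ^+ j.

Definition is_coords (m : motive) (c : 'I_d -> 'I_rank -> {poly F}) : Prop :=
  m = \sum_(i < d) \sum_(j < rank) motive_scale_Fq (c i j) (motive_basis i j).

End Drinfeld.

Arguments motive_basis {F K gamma} phi {d} eps i j.
Arguments is_coords {F K gamma} phi {d} eps m c.

Section Basis.

Variables (F : finFieldType) (K : fieldExtType F).
Variables (gamma : {lrmorphism {poly F} -> K}) (phi : drinfeld gamma).

Local Notation r := (rank phi).
Local Notation tauM j := (tau ^+ j : motive phi).

Lemma rank_gt0 : (0 < r)%N.
Proof.
rewrite /rank -subn1 subn_gt0 ltnNge; apply/negP => /size1_polyC phiT.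
have [a phi_a] := drinfeld_nonconst phi.
suff /(_ a)[x /phi_a] : forall b, exists x, phi b = oreC x by [].
elim/poly_ind => [|b c [x phi_b]].
  by exists 0; rewrite !rmorph0.
exists (x * (phi 'X : ore K)`_0 + c%:A).
have phi_c : phi c%:P = oreC c%:A.
  by rewrite -alg_polyC linearZ /= rmorph1; exact: mulr1.
rewrite rmorphD rmorphM /= phi_c.
by rewrite phi_b {1}phiT -/(oreC _) [RHS]rmorphD; congr (_ + _); rewrite rmorphM.
Qed.

Lemma motive_scaleXM (P : {poly K}) (m : motive phi) :
  (P * 'X) *: m = (P *: m : ore K) * phi 'X.
Proof.
rewrite mulrC -scalerA -['X]scale1r -[X in 1 *: X]expr1.
by rewrite [LHS]motive_scaleZXn rmorph1 mul1r expr1.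
Qed.

Lemma motive_scaleC (x : K) (m : motive phi) :
  x%:P *: m = oreC x * (m : ore K) :> ore K.
Proof.
have := motive_scaleZXn x 0 m.
by rewrite !expr0 rmorph1 mulr1 alg_polyC.
Qed.

Lemma size_oreM_phiT (f : ore K) : f != 0 ->
  (f * phi 'X : ore K)`_((size f).-1 + r) != 0.
Proof.
move=> f0; rewrite coef_oreM.
have lt_f : ((size f).-1 < ((size f).-1 + r).+1)%N by rewrite ltnS leq_addr.
rewrite (bigD1 (Ordinal lt_f)) //= addKn big1 ?addr0 => [|i ne_if].
  rewrite mulf_neq0 ?lead_coef_eq0 // fmorph_eq0 lead_coef_eq0.
  by apply: contraTneq rank_gt0 => phi0; rewrite /rank phi0 size_poly0.
have {ne_if} : (i : nat) != (size f).-1 by [].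
rewrite neq_ltn => /orP[lt_if | lt_fi]; last first.
  by rewrite nth_default ?mul0r // (leq_trans (leqSpred _)).
rewrite [(phi 'X : ore K)`__]nth_default ?rmorph0 ?mulr0 //.
rewrite (leq_trans (leqSpred _)) // -/(rank phi) ltn_subRL.
by rewrite ltn_add2r.
Qed.

Lemma motive_generated (m : motive phi) :
  exists P : 'I_r -> {poly K}, m = \sum_(j < r) P j *: tauM j.
Proof.
have [n] := ubnP (size (m : ore K)); elim: n m => // n IHn m.
rewrite ltnS => le_mn.
have [le_mr | lt_rm] := leqP (size (m : ore K)) r.
  exists (fun j => ((m : ore K)`_j)%:P); apply/polyP => k.
  rewrite [RHS]coef_sum.
  transitivity (\sum_(j < r) (m : ore K)`_j * (k == j)%:R); last first.
    by apply: eq_bigr => j _; rewrite motive_scaleC coef_oreCM tauX coefXn.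
  have [lt_kr | le_rk] := ltnP k r.
    rewrite (bigD1 (Ordinal lt_kr)) //= eqxx mulr1 big1 ?addr0 // => j.
    by rewrite -val_eqE /= eq_sym => /negPf->; rewrite mulr0.
  rewrite nth_default ?(leq_trans le_mr) // big1 // => j _.
  by rewrite gtn_eqF ?mulr0 // (leq_trans (ltn_ord j)).
pose s := ((size (m : ore K)).-1 - r)%N.
have phi0 : (phi 'X : ore K) != 0.
  by apply: contraTneq rank_gt0 => phi0; rewrite /rank phi0 size_poly0.
pose l := (phi 'X : ore K)`_r.
have l0 : frob s l != 0 by rewrite fmorph_eq0 lead_coef_eq0.
pose f : ore K := oreC ((m : ore K)`_(size (m : ore K)).-1 / frob s l) * tau ^+ s.
have coef_f k : f`_k =
    if k == s then (m : ore K)`_(size (m : ore K)).-1 / frob s l else 0.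
  rewrite coef_oreCM tauX coefXn.
  by case: eqP; rewrite ?mulr1 ?mulr0.
have Es : (s + r = (size (m : ore K)).-1)%N.
  by rewrite subnK // -ltnS (ltn_predK lt_rm).
have coef_fphi k : (f * phi 'X : ore K)`_k =
    if (s <= k)%N then f`_s * frob s (phi 'X : ore K)`_(k - s) else 0.
  rewrite coef_oreM; case: leqP => [le_sk | lt_ks].
    rewrite (bigD1 (Ordinal (le_sk : s < k.+1)%N)) //= big1 ?addr0 // => i.
    by rewrite -val_eqE /= coef_f => /negPf->; rewrite mul0r.
  rewrite big1 // => i _; rewrite coef_f ltn_eqF ?mul0r //.
  by rewrite (leq_ltn_trans _ lt_ks) // -ltnS.
have [|Q Ef] := IHn f.
  rewrite (@leq_ltn_trans s.+1) //.
    by apply/leq_sizeP => k lt_sk; rewrite coef_f gtn_eqF.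
  rewrite (leq_trans _ le_mn) // -[size _](ltn_predK lt_rm) -Es ltnS.
  by rewrite -[X in (X < _)%N]addn0 ltn_add2l rank_gt0.
have [|P Em] := IHn (m - (f * phi 'X : ore K)).
  rewrite (leq_trans _ le_mn) // -[size m](ltn_predK lt_rm) ltnS.
  apply/leq_sizeP => k; rewrite leq_eqVlt => /predU1P[<- | lt_mk].
    have top : (f * phi 'X : ore K)`_(size m).-1 = m`_(size m).-1.
      by rewrite coef_fphi -Es leq_addr addKn Es coef_f eqxx divfK.
    by rewrite coefB; apply/eqP; rewrite subr_eq0 -top.
  rewrite coefB coef_fphi nth_default; last first.
    by rewrite -(ltn_predK lt_rm).
  case: leqP => // le_sk; last by rewrite subrr.
  rewrite [_`_(k - s)]nth_default ?rmorph0 ?mulr0 ?subrr //.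
  rewrite (leq_trans (leqSpred _)) // -/(rank phi) ltn_subRL.
  by rewrite Es.
exists (fun j => P j + Q j * 'X).
rewrite -[LHS](subrK (f * phi 'X : ore K)) Em.
under [RHS]eq_bigr do rewrite scalerDl.
rewrite big_split /=; congr (_ + _).
rewrite {1}Ef mulr_suml; apply: eq_bigr => j _.
by rewrite motive_scaleXM.
Qed.

Lemma motive_free (P : 'I_r -> {poly K}) :
  \sum_(j < r) P j *: tauM j = 0 -> forall j, P j = 0.
Proof.
have [n] := ubnP (\max_(j < r) size (P j)); elim: n P => // n IHn P.
rewrite ltnS => /bigmax_leqP le_Pn P0.
pose Q j := drop_poly 1 (P j).
have EP j : P j = ((P j)`_0)%:P + Q j * 'X.
  rewrite -[LHS](poly_take_drop 1) expr1; congr (_ + _).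
  by apply/polyP => -[|k]; rewrite coef_take_poly coefC.
pose f : ore K := \sum_(j < r) Q j *: tauM j.
pose g : ore K := \sum_(j < r) oreC (P j)`_0 * tau ^+ j.
have gE : g + f * phi 'X = 0 :> ore K.
  rewrite -[RHS]P0 mulr_suml -big_split; apply: eq_bigr => j _.
  by rewrite [in RHS]EP [RHS]scalerDl motive_scaleXM motive_scaleC.
have coef_g k : g`_k = if insub k is Some j then (P j)`_0 else 0.
  rewrite coef_sum; case: insubP => [j _ <- | le_rk].
    rewrite (bigD1 j) //= coef_oreCM tauX coefXn eqxx mulr1.
    rewrite big1 ?addr0 // => i ne_ij.
    have {}ne_ij : (j : nat) != i by rewrite eq_sym.
    by rewrite coef_oreCM tauX coefXn (negPf ne_ij) mulr0.
  rewrite big1 // => i _; rewrite coef_oreCM tauX coefXn.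
  by rewrite gtn_eqF ?mulr0 // (leq_trans (ltn_ord i)) // leqNgt.
have f0 : f = 0.
  apply/eqP/idPn => /[dup] f0 /size_oreM_phiT /eqP[].
  have := congr1 (fun h : ore K => h`_((size f).-1 + r)) gE.
  rewrite coefD coef_g coef0 insubF ?add0r //.
  by rewrite ltnNge leq_addl.
have Pj0 j : (P j)`_0 = 0.
  have g0 : g = 0 by rewrite -gE f0 mul0r addr0.
  by have := coef_g j; rewrite valK g0 coef0.
have Q0 j : Q j = 0.
  case: n IHn le_Pn => [_ | n IHn] le_Pn.
    apply/polyP => k; rewrite coef_drop_poly coef0 nth_default //.
    by rewrite (leq_trans (le_Pn j _)).
  apply: IHn f0 j; rewrite ltnS; apply/bigmax_leqP => i _.
  by rewrite size_drop_poly leq_subLR (le_Pn i).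
by move=> j; rewrite EP Pj0 Q0 mul0r addr0.
Qed.

Variables (d : nat) (eps : d.-tuple K).
Hypothesis eps_basis : basis_of {:K} eps.

Lemma coords_sum (c : 'I_d -> 'I_r -> {poly F}) :
  \sum_(i < d) \sum_(j < r) motive_scale_Fq (c i j) (motive_basis phi eps i j) =
  \sum_(j < r) (\sum_(i < d) tnth eps i *: map_poly (in_alg K) (c i j)) *: tauM j.
Proof.
rewrite exchange_big; apply: eq_bigr => j _; rewrite scaler_suml.
apply: eq_bigr => i _; rewrite -mul_polyC mulrC -scalerA; congr (_ *: _).
by rewrite motive_scaleC.
Qed.

Lemma coords_exist (m : motive phi) : exists c, is_coords phi eps m c.
Proof.
have [P Em] := motive_generated m.
exists (fun i j => \poly_(k < size (P j)) coord eps i (P j)`_k).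
rewrite /is_coords coords_sum {1}Em; apply: eq_bigr => j _; congr (_ *: _).
apply/polyP => k; rewrite coef_sum.
under eq_bigr do rewrite coefZ coef_map coef_poly /=.
case: ltnP => [_ | le_Pk]; last first.
  by rewrite nth_default // big1 // => i _; rewrite scale0r mulr0.
rewrite {1}(coord_basis eps_basis (memvf (P j)`_k)); apply: eq_bigr => i _.
by rewrite -scalerAr mulr1 -tnth_nth.
Qed.

Lemma coords_unique (m : motive phi) c c' :
  is_coords phi eps m c -> is_coords phi eps m c' -> forall i j, c i j = c' i j.
Proof.
rewrite /is_coords !coords_sum => -> /eqP; rewrite -subr_eq0 -sumrB => /eqP.
under eq_bigr do rewrite -scalerBl.
move/motive_free => Ecc' i j; apply/polyP => k; apply/eqP; rewrite -subr_eq0.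
have /(congr1 (fun p : {poly K} => p`_k)) := Ecc' j.
rewrite coefB !coef_sum -sumrB coef0 => E0.
have : \sum_(l < d) ((c l j)`_k - (c' l j)`_k) *: eps`_l = 0.
  rewrite -[RHS]E0; apply: eq_bigr => l _.
  by rewrite !coefZ !coef_map /= -mulrBr -scalerBl -scalerAr mulr1 -tnth_nth.
have /freeP eps_free := basis_free eps_basis.
by move/eps_free->.
Qed.

End Basis.

(* Main.v *)
Require Import Defs.
From mathcomp Require Import all_boot all_order all_algebra all_field.

Set Implicit Arguments.
Unset Strict Implicit.
Unset Printing Implicit Defensive.

(** Write q for the order of F. Both sides of the equivalence say that phi_a
    is a right factor of tau^d - 1 in K{tau}.

    On the arithmetic side, F[T] acts on the motive by right multiplication
    through phi, so right multiples of phi_a are the elements a . f; by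
    freeness over F[T], these are the elements all of whose coordinates are
    divisible by a (dvd_coordsP), i.e., those with coordinates of gcd
    divisible by a.

    On the geometric side, K has q^d elements, so K is the set of roots of
    X^(q^d) - X in the algebraic closure, that is, the kernel of tau^d - 1
    (frob_fixed_field). Hence the a-torsion is rational exactly when
    ker phi_a is contained in ker (tau^d - 1). A right factor has a smaller
    kernel. Conversely, a being coprime to the characteristic p, the constant
    coefficient gamma(a) of phi_a is nonzero, so phi_a is separable and its
    kernel is as large as its degree permits; the remainder of the right
    division of tau^d - 1 by phi_a vanishes on this kernel but has smaller
    degree, so it is zero (ore_right_dvd_kernel). *)

Import GRing.Theory.
Local Open Scope ring_scope.

Section OreDivision.

Variables (F : finFieldType) (K : fieldExtType F).

Local Notation q := #|F|.

Implicit Types f g h s : ore K.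

Lemma coef_oreC_tauM x n g k :
  (oreC x * tau ^+ n * g)`_k = if (n <= k)%N then x * frob n g`_(k - n) else 0.
Proof.
rewrite -mulrA coef_oreCM coef_oreM; under eq_bigr do rewrite tauX coefXn.
case: leqP => [le_nk | lt_kn].
  rewrite (bigD1 (Ordinal (le_nk : n < k.+1)%N)) //= eqxx mul1r big1 ?addr0 //.
  by move=> i; rewrite -val_eqE /= => /negPf->; rewrite mul0r.
rewrite big1 ?mulr0 // => i _.
by rewrite ltn_eqF ?mul0r // (leq_ltn_trans _ lt_kn) // -ltnS.
Qed.

(** Leading terms can be cancelled by left multiples of g over any field,
    perfect or not: the coefficient to be inverted is the image of the leading
    coefficient of g by a power of Frobenius, and no q-th root is taken. *)
Lemma ore_right_division f g : g != 0 ->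
  exists h s, f = h * g + s /\ (size s < size g)%N.
Proof.
move=> g0; have sg0 : (0 < size g)%N by rewrite size_poly_gt0.
have [n] := ubnP (size f); elim: n f => // n IHn f; rewrite ltnS => le_fn.
have [le_gf | lt_fg] := leqP (size g) (size f); last first.
  by exists 0, f; rewrite mul0r add0r.
pose e := (size f - size g)%N.
have l0 : frob e g`_(size g).-1 != 0 by rewrite fmorph_eq0 lead_coef_eq0.
pose t := oreC (f`_(size f).-1 / frob e g`_(size g).-1) * tau ^+ e : ore K.
have Ee : ((size f).-1 - e = (size g).-1)%N.
  by rewrite -subn1 -subnDA addnC subnDA subKn // subn1.
have [|h [s [Ef lt_sg]]] := IHn (f - t * g); last first.
  exists (t + h), s; split=> //.
  by rewrite mulrDl -addrA -Ef addrC subrK.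
have sf0 : (0 < size f)%N by apply: leq_trans le_gf.
rewrite (leq_trans _ le_fn) // -[size f](ltn_predK sf0) ltnS.
apply/leq_sizeP => k; rewrite coefB coef_oreC_tauM leq_eqVlt.
case/predU1P=> [<- | lt_fk].
  rewrite Ee divfK // ifT ?subrr // leq_subLR.
  by rewrite -[size f in X in (X <= _)%N](ltn_predK sf0) -add1n leq_add2r.
have le_fk : (size f <= k)%N by rewrite -(ltn_predK sf0).
rewrite nth_default //; case: leqP => [le_ek|]; last by rewrite subrr.
rewrite [g`_(k - e)]nth_default ?rmorph0 ?mulr0 ?subrr //.
by rewrite leq_subRL // subnK.
Qed.

End OreDivision.

Section LinearizedPolynomial.

Variables (F : finFieldType) (K : fieldExtType F).
Variables (E : fieldType) (iota : {rmorphism K -> E}).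

Local Notation q := #|F|.

Implicit Types f g : ore K.

Definition linearized f : {poly E} :=
  \sum_(i < size f) iota f`_i *: 'X^(q ^ i).

Lemma horner_linearized f z : (linearized f).[z] = ore_eval iota f z.
Proof.
by rewrite horner_sum; apply: eq_bigr => i _; rewrite hornerZ hornerXn.
Qed.

Lemma coef_linearized f i : (linearized f)`_(q ^ i) = iota f`_i.
Proof.
have [lt_if | le_fi] := ltnP i (size f); rewrite coef_sum.
  rewrite (bigD1 (Ordinal lt_if)) //= coefZ coefXn eqxx mulr1 big1 ?addr0 // => j.
  rewrite -val_eqE /= eq_sym coefZ coefXn eqn_exp2l ?finNzRing_gt1 // => /negPf->.
  by rewrite mulr0.
rewrite [f`_i]nth_default // rmorph0 big1 // => j _.
rewrite coefZ coefXn eqn_exp2l ?finNzRing_gt1 // gtn_eqF ?mulr0 //.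
exact: leq_trans le_fi.
Qed.

(** For n > 0 the degree is at most q^(n-1), which is smaller than q^n because q > 1;
    the bound on the size, which exceeds the degree by one, follows. *)
Lemma size_linearized_le f n : (size f <= n)%N ->
  (size (linearized f) <= q ^ n)%N.
Proof.
move=> le_fn; apply: (leq_trans (size_sum _ _ _)); apply/bigmax_leqP => i _.
rewrite (leq_trans (size_scale_leq _ _)) // size_polyXn.
by rewrite ltn_exp2l ?finNzRing_gt1 // (leq_trans _ le_fn).
Qed.

Lemma size_linearized_gt f n : f`_n != 0 -> (q ^ n < size (linearized f))%N.
Proof.
move=> fn0; rewrite ltnNge; apply: contraNN fn0 => le_fn.
by rewrite -(fmorph_eq0 iota) -coef_linearized nth_default.
Qed.

Lemma card_pchar0 : q%:R = 0 :> E.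
Proof.
have qE : [pchar E].-nat q.
  by rewrite (eq_pnat _ (fmorph_pchar iota)) -[q]expn1 card_pchar_nat.
apply/eqP/idPn; rewrite natf_neq0_pchar => qE'.
by have := finNzRing_gt1 F; rewrite (pnat_1 qE qE').
Qed.

(** All exponents but the first are multiples of q, which is zero in E. *)
Lemma deriv_linearized f : (linearized f)^`() = (iota f`_0)%:P.
Proof.
have derivXq i : ('X^(q ^ i))^`() = (i == 0)%N%:R :> {poly E}.
  rewrite derivXn; case: i => [|i]; first by rewrite expn0 expr0.
  by rewrite -mulr_natr natrX -polyC_natr card_pchar0 expr0n mulr0.
rewrite raddf_sum /=; under eq_bigr do rewrite derivZ derivXq.
have [/eqP | f_gt0] := posnP (size f).
  rewrite size_poly_eq0 => /eqP->.
  by rewrite size_poly0 big_ord0 coef0 rmorph0.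
rewrite (bigD1 (Ordinal f_gt0)) //= big1 ?addr0 ?alg_polyC // => i.
by rewrite -val_eqE /= => /negPf->; rewrite scaler0.
Qed.

Lemma separable_linearized f : f`_0 != 0 -> separable_poly (linearized f).
Proof.
move=> f0; rewrite unlock deriv_linearized.
by rewrite -alg_polyC coprimepZr ?fmorph_eq0 ?coprimep1.
Qed.

End LinearizedPolynomial.

Lemma ore_eval0 (F : finFieldType) (K : fieldExtType F)
    (E : fieldType) (iota : {rmorphism K -> E}) (f : ore K) :
  ore_eval iota f 0 = 0.
Proof.
rewrite /ore_eval big1 // => i _.
by rewrite expr0n expn_eq0 gtn_eqF ?mulr0 // (ltnW (finNzRing_gt1 F)).
Qed.

(** A separable g has q^(deg g) distinct roots in E, whereas the remainder
    of the right division of f by g has an associated polynomial of degree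
    less than q^(deg g); since it vanishes at all the roots of g, it is zero.
    Without the hypothesis on the constant coefficient this fails: tau has
    trivial kernel but is not a right factor of 1. *)
Lemma ore_right_dvd_kernel (F : finFieldType) (K : fieldExtType F)
    (E : closedFieldType) (iota : {rmorphism K -> E}) (f g : ore K) :
    g`_0 != 0 ->
    (forall z, ore_eval iota g z = 0 -> ore_eval iota f z = 0) ->
  exists h : ore K, f = h * g.
Proof.
move=> g00 kerS; have g0 : g != 0 by apply: contraNneq g00 => ->; rewrite coef0.
have [h [s [Ef lt_sg]]] := ore_right_division f g0; exists h.
suff s0 : s = 0 by rewrite Ef s0 addr0.
have [rs Eg] := closed_field_poly_normal (linearized iota g).
have lg0 : linearized iota g != 0.
  apply: contraNneq g00 => lg0.
  by rewrite -(fmorph_eq0 iota) -coef_linearized lg0 coef0.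
have rs_uniq : uniq rs.
  rewrite -separable_prod_XsubC.
  apply: dvdp_separable (separable_linearized iota g00).
  by rewrite Eg dvdpZr ?lead_coef_eq0.
have ls0 : linearized iota s = 0.
  apply: (@roots_geq_poly_eq0 _ _ rs) => //.
    apply/allP => z z_rs.
    have gz : ore_eval iota g z = 0.
      rewrite -horner_linearized Eg hornerZ.
      by move: z_rs; rewrite -root_prod_XsubC => /rootP->; rewrite mulr0.
    rewrite rootE horner_linearized; have := kerS _ gz.
    rewrite Ef ore_evalD ore_evalM gz => <-.
    by rewrite ore_eval0 add0r.
  have -> : size rs = (size (linearized iota g)).-1.
    by rewrite Eg size_scale ?lead_coef_eq0 // size_prod_XsubC.
  have lt_pg : (#|F| ^ (size g).-1 < size (linearized iota g))%N.
    by apply: size_linearized_gt; rewrite lead_coef_eq0.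
  rewrite -ltnS (ltn_predK lt_pg) (leq_ltn_trans _ lt_pg) //.
  by apply: size_linearized_le; rewrite -ltnS (ltn_predK lt_sg).
apply: (@ore_eval_inj _ _ _ iota) => z.
by rewrite -horner_linearized ls0 horner0 /ore_eval size_poly0 big_ord0.
Qed.

(** The elements of K are all the roots of X^(q^d) - X, as this polynomial
    splits over the finite field K into the factors X - x. *)
Lemma frob_fixed_field (F : finFieldType) (K : fieldExtType F)
    (E : fieldType) (iota : {rmorphism K -> E}) (z : E) :
  z ^+ (#|F| ^ \dim {:K}) = z <-> exists x, z = iota x.
Proof.
(* L is K equipped with its structure of finite type. *)
pose L : finFieldType := finvect_type K.
pose iotaL : {rmorphism L -> E} := iota.
have cardK : #|L| = (#|F| ^ \dim {:K})%N.
  rewrite -[RHS](card_vspace (T := finvect_type K) {:K}); exact/esym/card_vspacef.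
split=> [z_fix | [x ->]].
  have := congr1 (map_poly iotaL) (finField_genPoly L).
  rewrite rmorphB /= map_polyXn map_polyX map_prod_XsubC cardK.
  move/(congr1 (fun P : {poly E} => P.[z])).
  rewrite hornerD hornerN hornerXn hornerX z_fix subrr horner_prod.
  move/esym/eqP; rewrite prodf_seq_eq0 => /hasP[x _].
  by rewrite hornerXsubC subr_eq0 => /eqP->; exists x.
rewrite -rmorphXn; congr (iota _).
by rewrite -cardK; apply: (@expf_card L).
Qed.

Lemma ore_eval_tauXB1 (F : finFieldType) (K : fieldExtType F)
    (E : fieldType) (iota : {rmorphism K -> E}) n z :
  ore_eval iota (tau ^+ n - 1) z = z ^+ (#|F| ^ n) - z.
Proof.
have eval1 w : ore_eval iota 1 w = w.
  by rewrite /ore_eval size_poly1 big_ord1 coef1 rmorph1 mul1r expr1.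
apply: (addIr (ore_eval iota 1 z)); rewrite -ore_evalD !subrK eval1 subrK.
elim: n z => [|n IHn] z; first by rewrite eval1 expr1.
by rewrite exprSr ore_evalMtau IHn -exprM expnS.
Qed.

Lemma dvdp_biggcdP (R : idomainType) (I : finType) (G : I -> {poly R}) a :
  a %| \big[@gcdp R/0]_i G i <-> forall i, a %| G i.
Proof.
rewrite (big_morph (dvdp a) (dvdp_gcd a) (dvdp0 a)) big_andE.
by split=> [/forallP | aG]; last apply/forallP.
Qed.

Lemma coords_motive_scale (F : finFieldType) (K : fieldExtType F)
    (gamma : {lrmorphism {poly F} -> K}) (phi : drinfeld gamma)
    d (eps : d.-tuple K) (m : motive phi) c a :
  is_coords phi eps m c ->
  is_coords phi eps (motive_scale_Fq a m) (fun i j => a * c i j).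
Proof.
rewrite /is_coords !motive_scale_FqE => {1}->; rewrite mulr_suml.
apply: eq_bigr => i _; rewrite mulr_suml; apply: eq_bigr => j _.
by rewrite !motive_scale_FqE mulrC rmorphM mulrA.
Qed.

(** The element f * phi_a is a . f, whose coordinates are a times those of f;
    so a divides them, by uniqueness of coordinates. Conversely, dividing the
    coordinates of m by a yields those of a suitable f. *)
Lemma dvd_coordsP (F : finFieldType) (K : fieldExtType F)
    (gamma : {lrmorphism {poly F} -> K}) (phi : drinfeld gamma)
    d (eps : d.-tuple K) (eps_basis : basis_of {:K} eps)
    (m : motive phi) c a :
  is_coords phi eps m c ->
  (forall i j, a %| c i j) <-> exists f : ore K, m = f * phi a.
Proof.
move=> m_c; split=> [a_c | [f Em]].
  pose b i j := c i j %/ a.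
  exists (\sum_(i < d) \sum_(j < rank phi)
           motive_scale_Fq (b i j) (motive_basis phi eps i j)).
  rewrite -motive_scale_FqE [LHS]m_c.
  rewrite [RHS](coords_motive_scale a (erefl _ : is_coords phi eps _ b)).
  apply: eq_bigr => i _; apply: eq_bigr => j _.
  by rewrite mulrC divpK.
have [b f_b] := coords_exist eps_basis (f : motive phi).
have := coords_motive_scale a f_b.
rewrite motive_scale_FqE -Em => /(coords_unique eps_basis m_c) Ec i j.
by rewrite Ec dvdp_mulr.
Qed.

Theorem proposition5p2
  (F : finFieldType) (K : fieldExtType F) (d : nat) (hd : \dim {:K} = d)
  (Kbar : closedFieldType) (iota : {rmorphism K -> Kbar})
  (Kbar_alg : forall z : Kbar, algebraicOver iota z)
  (gamma : {lrmorphism {poly F} -> K})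
  (p : {poly F}) (p_monic : p \is monic)
  (ker_gamma : forall b : {poly F}, gamma b = 0 <-> p %| b)
  (phi : drinfeld gamma)
  (eps : d.-tuple K) (eps_basis : basis_of {:K} eps)
  (c : 'I_d -> 'I_(rank phi) -> {poly F})
  (c_coords : is_coords phi eps (tau ^+ d - 1 : ore K) c)
  (a : {poly F}) (a_coprime : coprimep a p) :
  rational_torsion phi iota a <->
  a %| \big[@gcdp F/0]_(i < d) \big[@gcdp F/0]_(j < rank phi) c i j.
Proof.
(* Otherwise p would divide a, hence be a unit, and gamma 1 would vanish. *)
have gamma_a : gamma a != 0.
  apply/eqP => /ker_gamma p_a.
  have p1 : p %= 1 by have /coprimepP := a_coprime; apply.
  have /eqP : gamma 1 = 0 by apply/ker_gamma; rewrite (eqp_dvdl _ p1).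
  by rewrite rmorph1 oner_eq0.
have dvd_gP := dvd_coordsP eps_basis a c_coords.
apply: (@iff_trans _ (exists f : ore K, tau ^+ d - 1 = f * phi a)); last first.
  split=> [/dvd_gP a_c | /dvdp_biggcdP a_g].
    by do 2!apply/dvdp_biggcdP=> ?.
  by apply/dvd_gP => i; apply/dvdp_biggcdP.
split=> [torsK | [f Ef] z].
  apply: (ore_right_dvd_kernel (iota := iota)); first by rewrite drinfeld_coef0.
  move=> z /eqP/torsK; rewrite ore_eval_tauXB1 -hd.
  by move/frob_fixed_field->; rewrite subrr.
rewrite inE => /eqP az; apply/frob_fixed_field/eqP.
by rewrite -subr_eq0 hd -(ore_eval_tauXB1 iota) Ef ore_evalM az ore_eval0.
Qed.
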